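(* Let $r\in[2,\infty)$ and let $(X,\|\cdot\|)$ be an $r$-uniformly convex space with constant $c_r$. Let $n\ge1$, let $T_i:X\to X$ be quasi $\alpha_i$-firmly nonexpansive operators with constants $\alpha_i\in(0,1)$, $i=1,\dots,n$, and let $w_1,\dots,w_n\in[0,1]$ with $\sum_{i=1}^nw_i=1$. Let $T:=T_nT_{n-1}\cdots T_2T_1$ and $S:=\sum_{i=1}^nw_iT_i$. If $\bigcap_{i=1}^n\mathrm{Fix}\,T_i\ne\emptyset$, then $S$ and $T$ are also quasi $\alpha$-firmly nonexpansive operators (each for some constant $\alpha\in(0,1)$).
   Context: For $r\in[2,\infty)$, a normed space $(X,\|\cdot\|)$ is called $r$-uniformly convex (with constant $c_r$) if there is a constant $c_r>0$ such that for all $w\in[0,1]$ and all $x,y\in X$ $$\|(1-w)x+wy\|^r\le(1-w)\|x\|^r+w\|y\|^r-\frac{c_r}{2}w(1-w)\|x-y\|^r.$$ The constant $c_r$ is fixed. Operators are maps $X\to X$, not necessarily linear; $\mathrm{Fix}\,T=\{x\in X:Tx=x\}$; $\mathrm{I}$ is the identity. For $\alpha\in(0,1)$, $T:X\to X$ is quasi $\alpha$-firmly nonexpansive if $\mathrm{Fix}\,T\ne\emptyset$ and for all $x\in X$ and all $y\in\mathrm{Fix}\,T$ $$\|Tx-Ty\|^r\le\|x-y\|^r-\frac{c_r}{2}\,\frac{1-\alpha}{\alpha}\,\|(\mathrm{I}-T)x-(\mathrm{I}-T)y\|^r.$$ *)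

(* Defs.v *)
From HB Require Import structures.
From mathcomp Require Import all_boot all_order all_algebra.
From mathcomp Require Import all_classical all_reals all_analysis.
Set Implicit Arguments.
Unset Strict Implicit.
Unset Printing Implicit Defensive.
Import Order.TTheory GRing.Theory Num.Theory numFieldNormedType.Exports.
Local Open Scope classical_set_scope.
Local Open Scope ring_scope.

Definition uniformly_convex (R : realType) (X : normedModType R) (r c : R) : Prop :=
  0 < c /\
  forall (w : R) (x y : X), 0 <= w <= 1 ->
    `|(1 - w) *: x + w *: y| `^ r <=
      (1 - w) * `|x| `^ r + w * `|y| `^ r
      - c / 2 * w * (1 - w) * `|x - y| `^ r.

Definition fixed_points (X : Type) (T : X -> X) : set X := [set x | T x = x].

(* The condition [0 < alpha < 1] is not part of this predicate. *)
Definition quasi_firmly_nonexpansive (R : realType) (X : normedModType R)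
    (r c alpha : R) (T : X -> X) : Prop :=
  fixed_points T !=set0 /\
  forall x y : X, fixed_points T y ->
    `|T x - T y| `^ r <=
      `|x - y| `^ r
      - c / 2 * ((1 - alpha) / alpha) * `|(x - T x) - (y - T y)| `^ r.

(* [rev_ord] puts the operators in the order T_(n-1) \o ... \o T_1 \o T_0:
   T_0 is applied first. *)
Definition operator_composition (X : Type) (n : nat) (T : 'I_n -> X -> X) : X -> X :=
  \big[(fun f g : X -> X => f \o g)/id]_(i < n) T (rev_ord i).

Definition operator_combination (R : realType) (X : normedModType R) (n : nat)
    (w : 'I_n -> R) (T : 'I_n -> X -> X) : X -> X :=
  fun x => \sum_(i < n) w i *: T i x.

(* Main.v *)
Require Import Defs.
From HB Require Import structures.
From mathcomp Require Import all_boot all_order all_algebra.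
From mathcomp Require Import all_classical all_reals all_analysis.
From mathcomp Require Import ring lra.
Import Order.TTheory GRing.Theory Num.Theory numFieldNormedType.Exports.
Local Open Scope classical_set_scope.
Local Open Scope ring_scope.
Set Implicit Arguments.
Unset Strict Implicit.

(** At a fixed point [y] the displacement [y - T y] vanishes, so an operator is
    quasi firmly nonexpansive for some [alpha] exactly when it has a fixed point
    and satisfies [`|T x - y|^r <= `|x - y|^r - k * `|x - T x|^r] at all its
    fixed points [y], for some [k > 0]: the map
    [alpha |-> c / 2 * ((1 - alpha) / alpha)] is a bijection from ]0, 1[ to
    ]0, +oo[.  Only the existence of a rate [k > 0] thus matters.

    Two facts give such a rate for a sum or a product of operators with a common
    fixed point [z].  Chaining the inequalities of the operators at [z] shows
    that a fixed point [x] of the compound satisfies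
    [`|x - z|^r <= `|x - z|^r - (positive combination of displacements of x)],
    so all these displacements vanish: the fixed points of the compound are
    common fixed points of its (active) factors.  Hence the same chain of
    inequalities is available at every fixed point of the compound, and it
    remains to bound the displacement of the compound by the displacements of
    its factors ([jensen] for sums, [powR_normD] for products).  Both bounds
    express the convexity of [`|.|^r], which is what remains of uniform
    convexity when its last term is dropped. *)

(** Normalised partial sums lose their meaning when the partial weight is zero,
    so the induction carries instead a point [u] such that the partial sum is
    its total weight times [u]; when the weight is zero any [u] will do. *)
Lemma jensen (R : realFieldType) (V : lmodType R) (f : V -> R)
    (f_convex : forall (t : R) (x y : V), 0 <= t <= 1 ->
      f ((1 - t) *: x + t *: y) <= (1 - t) * f x + t * f y)
    (I : finType) (w : I -> R) (v : I -> V) :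
  (forall i, 0 <= w i) -> \sum_i w i = 1 ->
  f (\sum_i w i *: v i) <= \sum_i w i * f (v i).
Proof.
move=> w_ge0 w_sum.
pose K (W : R) (s : V) (F : R) := exists u, [/\ s = W *: u, 0 <= W & W * f u <= F].
suff [u [-> _]] : K (\sum_i w i) (\sum_i w i *: v i) (\sum_i w i * f (v i)).
  by rewrite w_sum scale1r mul1r.
apply: (big_ind3 K).
- by exists 0; split; rewrite ?scaler0 ?mul0r.
- move=> W1 s1 F1 W2 s2 F2 [u1 [-> W1_ge0 le1]] [u2 [-> W2_ge0 le2]].
  have [W0|W_neq0] := eqVneq (W1 + W2) 0.
    have [W10 W20] : W1 = 0 /\ W2 = 0 by split; lra.
    exists 0; split; first by rewrite W10 W20 addr0 !scale0r addr0.
      by rewrite W0.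
    by rewrite W0 mul0r; move: le1 le2; rewrite W10 W20 !mul0r; exact: addr_ge0.
  have W_gt0 : 0 < W1 + W2 by rewrite lt_def W_neq0 addr_ge0.
  pose t := W2 / (W1 + W2).
  have t01 : 0 <= t <= 1.
    by rewrite /t divr_ge0 ?(ltW W_gt0)//= ler_pdivrMr// mul1r lerDr.
  have E2 : (W1 + W2) * t = W2 by rewrite /t mulrC divfK.
  have E1 : (W1 + W2) * (1 - t) = W1 by rewrite mulrBr E2 mulr1 addrK.
  clearbody t.
  exists ((1 - t) *: u1 + t *: u2); split; last 2 first.
  + exact: ltW.
  + apply: (le_trans (ler_wpM2l (ltW W_gt0) (f_convex _ u1 u2 t01))).
    by rewrite mulrDr !mulrA E1 E2 lerD.
  + by rewrite scalerDr !scalerA E1 E2.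
- by move=> i _; exists (v i).
Qed.

Section FirmRate.
Context (R : realType) (X : normedModType R) (r : R).

(** The inequality of quasi firm nonexpansiveness, with the coefficient
    [c / 2 * ((1 - alpha) / alpha)] replaced by a free rate [k]. *)
Definition has_firm_rate (k : R) (T : X -> X) : Prop :=
  forall x y, fixed_points T y ->
    `|T x - y| `^ r <= `|x - y| `^ r - k * `|x - T x| `^ r.

Lemma quasi_firmly_nonexpansive_rate c alpha T :
  quasi_firmly_nonexpansive r c alpha T ->
  has_firm_rate (c / 2 * ((1 - alpha) / alpha)) T.
Proof.
by move=> [_ T_firm] x y Ty; have := T_firm x y Ty; rewrite Ty subrr subr0.
Qed.

Lemma has_firm_rate_quasi c k T : 0 < c -> 0 < k ->
  fixed_points T !=set0 -> has_firm_rate k T ->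
  exists a : R, 0 < a < 1 /\ quasi_firmly_nonexpansive r c a T.
Proof.
move=> c_gt0 k_gt0 T_fix T_firm.
have d_gt0 : 0 < c + 2 * k by rewrite addr_gt0// mulr_gt0.
(* the solution of c / 2 * ((1 - a) / a) = k *)
exists (c / (c + 2 * k)); split.
  by rewrite divr_gt0//= ltr_pdivrMr// mul1r ltrDl mulr_gt0.
split=> // x y Ty.
have -> : c / 2 * ((1 - c / (c + 2 * k)) / (c / (c + 2 * k))) = k.
  by field; rewrite !gt_eqF.
by have := T_firm x y Ty; rewrite Ty subrr subr0.
Qed.

Lemma has_firm_rate_le k l T : l <= k -> has_firm_rate k T -> has_firm_rate l T.
Proof.
move=> lk T_firm x y Ty; apply: le_trans (T_firm x y Ty) _.
by rewrite lerB// ler_wpM2r// powR_ge0.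
Qed.

Lemma powR_norm_le0 (v : X) : `|v| `^ r <= 0 -> v = 0.
Proof.
move=> v_le0; have /eqP : `|v| `^ r = 0 by apply/le_anti; rewrite v_le0 powR_ge0.
by rewrite powR_eq0 => /andP[/eqP /normr0_eq0].
Qed.

Lemma has_firm_rate_id k : 0 < r -> has_firm_rate k id.
Proof. by move=> r_gt0 x y _; rewrite subrr normr0 powR0 ?mulr0 ?subr0 ?gt_eqF. Qed.

Context (c : R).
Hypothesis X_convex : uniformly_convex X r c.

Lemma powR_norm_convex (t : R) (x y : X) : 0 <= t <= 1 ->
  `|(1 - t) *: x + t *: y| `^ r <= (1 - t) * `|x| `^ r + t * `|y| `^ r.
Proof.
move=> t01; have [c_gt0 /(_ t x y t01) /le_trans] := X_convex; apply.
move: t01 => /andP[t_ge0 t_le1].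
by rewrite lerBlDr lerDl !mulr_ge0 ?invr_ge0 ?subr_ge0 ?powR_ge0// ltW.
Qed.

(** Convexity at the midpoint of [2 x] and [2 y]. *)
Lemma powR_normD (x y : X) :
  `|x + y| `^ r <= 2 `^ r * (`|x| `^ r + `|y| `^ r).
Proof.
have h01 : 0 <= (2^-1 : R) <= 1 by apply/andP; split; lra.
have := @powR_norm_convex 2^-1 (2 *: x) (2 *: y) h01.
have -> : 1 - 2^-1 = (2^-1 : R) by lra.
rewrite !scalerA mulVf// !scale1r !normrZ ger0_norm// !powRM//.
have := powR_ge0 2 r; have := powR_ge0 `|x| r; have := powR_ge0 `|y| r.
move=> *; nra.
Qed.

Lemma has_firm_rate_comp k l (S T : X -> X) (z : X) :
  0 < k -> 0 < l -> fixed_points S z -> fixed_points T z ->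
  has_firm_rate k S -> has_firm_rate l T ->
  exists2 m, 0 < m & has_firm_rate m (S \o T).
Proof.
move=> k_gt0 l_gt0 Sz Tz S_firm T_firm.
pose q := Num.min k l.
have q_gt0 : 0 < q by rewrite lt_min k_gt0.
have {}S_firm : has_firm_rate q S by apply: has_firm_rate_le S_firm; rewrite ge_min lexx.
have {}T_firm : has_firm_rate q T
  by apply: has_firm_rate_le T_firm; rewrite ge_min lexx orbT.
have chain x y : fixed_points S y -> fixed_points T y ->
    `|S (T x) - y| `^ r <=
    `|x - y| `^ r - q * (`|x - T x| `^ r + `|T x - S (T x)| `^ r).
  by move=> Sy Ty; have := S_firm (T x) y Sy; have := T_firm x y Ty; lra.
have fixed_comp y : fixed_points (S \o T) y -> fixed_points S y /\ fixed_points T y.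
  rewrite /fixed_points/= => STy; have := chain y z Sz Tz; rewrite STy => le_z.
  have Ty : T y = y.
    apply/esym/subr0_eq/powR_norm_le0; rewrite -(pmulr_rle0 _ q_gt0).
    by have := mulr_ge0 (ltW q_gt0) (powR_ge0 `|T y - y| r); lra.
  by split=> //; rewrite /fixed_points/= -{1}Ty.
have p_gt0 : 0 < 2 `^ r :> R by rewrite powR_gt0.
exists (q / 2 `^ r); first exact: divr_gt0.
move=> x y /fixed_comp[Sy Ty]; apply: le_trans (chain x y Sy Ty) _.
rewrite lerB// -mulrA ler_pM2l// ler_pdivrMl//=.
have -> : x - S (T x) = (x - T x) + (T x - S (T x)) by rewrite addrA subrK.
exact: powR_normD.
Qed.

Lemma has_firm_rate_combination n (w k : 'I_n -> R) (T : 'I_n -> X -> X) (z : X) :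
  (forall i, 0 <= w i) -> \sum_(i < n) w i = 1 ->
  (forall i, 0 < k i) -> (forall i, has_firm_rate (k i) (T i)) ->
  (forall i, fixed_points (T i) z) ->
  exists2 m, 0 < m & has_firm_rate m (operator_combination w T).
Proof.
move=> w_ge0 w_sum k_gt0 T_firm Tz.
pose q := \big[Num.min/1]_(i < n) k i.
have q_gt0 : 0 < q by apply: lt_bigmin.
have {}T_firm i : has_firm_rate q (T i).
  by apply: has_firm_rate_le (T_firm i); apply: bigmin_le_cond.
have pull (v : X) : v = \sum_(i < n) w i *: v by rewrite -scaler_suml w_sum scale1r.
(* operators of weight zero do not constrain the fixed points of the sum *)
have chain x y : (forall i, w i != 0 -> fixed_points (T i) y) ->
    `|operator_combination w T x - y| `^ r <=
    `|x - y| `^ r - q * \sum_(i < n) w i * `|x - T i x| `^ r.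
  move=> Ty; rewrite {1}[y]pull /operator_combination -sumrB.
  under eq_bigr do rewrite -scalerBr.
  apply: le_trans (jensen powR_norm_convex _ w_ge0 w_sum) _.
  rewrite -[`|x - y| `^ r]mul1r -w_sum mulr_suml mulr_sumr -sumrB.
  apply: ler_sum => i _; have [->|wi] := eqVneq (w i) 0.
    by rewrite !mul0r mulr0 subr0.
  by rewrite mulrCA -mulrBr ler_wpM2l// T_firm//; exact: Ty.
have fixed_comb y : fixed_points (operator_combination w T) y ->
    forall i, w i != 0 -> fixed_points (T i) y.
  move=> Sy i wi; have := chain y z (fun i _ => Tz i); rewrite Sy => le_z.
  have terms_ge0 j : 0 <= w j * `|y - T j y| `^ r by rewrite mulr_ge0 ?powR_ge0.
  have sum_le0 : \sum_(j < n) w j * `|y - T j y| `^ r <= 0.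
    by rewrite -(pmulr_rle0 _ q_gt0); lra.
  apply/esym/subr0_eq/powR_norm_le0.
  have wi_gt0 : 0 < w i by rewrite lt_def wi w_ge0.
  rewrite -(pmulr_rle0 _ wi_gt0).
  by apply: le_trans sum_le0; rewrite (bigD1 i)//= lerDl sumr_ge0.
exists q => // x y /fixed_comb Ty; apply: le_trans (chain x y Ty) _.
rewrite lerB// ler_pM2l// {1}[x]pull /operator_combination -sumrB.
under eq_bigr do rewrite -scalerBr.
exact: (jensen powR_norm_convex _ w_ge0 w_sum).
Qed.

(** The induction must remember that the partial products fix [z], since
    [has_firm_rate_comp] needs a common fixed point of its two factors. *)
Lemma has_firm_rate_composition n (k : 'I_n -> R) (T : 'I_n -> X -> X) (z : X) :
  0 < r -> (forall i, 0 < k i) -> (forall i, has_firm_rate (k i) (T i)) ->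
  (forall i, fixed_points (T i) z) ->
  fixed_points (operator_composition T) z /\
  exists2 m, 0 < m & has_firm_rate m (operator_composition T).
Proof.
move=> r_gt0 k_gt0 T_firm Tz.
pose P (f : X -> X) := fixed_points f z /\ exists2 m, 0 < m & has_firm_rate m f.
apply: (big_ind P).
- by split=> //; exists 1 => //; exact: has_firm_rate_id.
- move=> f g [fz [a a_gt0 f_firm]] [gz [b b_gt0 g_firm]]; split.
    by rewrite /fixed_points/= gz fz.
  exact: has_firm_rate_comp a_gt0 b_gt0 fz gz f_firm g_firm.
- by move=> i _; split=> //; exists (k (rev_ord i)).
Qed.

End FirmRate.

Unset Implicit Arguments.
Set Strict Implicit.

Theorem proposition4p3 (R : realType) (X : normedModType R) (r c : R)
    (hr : 2 <= r) (hX : uniformly_convex X r c)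
    (n : nat) (hn : (1 <= n)%N)
    (T : 'I_n -> X -> X) (alpha : 'I_n -> R)
    (halpha : forall i, 0 < alpha i < 1)
    (hT : forall i, quasi_firmly_nonexpansive r c (alpha i) (T i))
    (w : 'I_n -> R) (hw : forall i, 0 <= w i <= 1)
    (hw1 : \sum_(i < n) w i = 1)
    (hfix : \bigcap_(i in [set: 'I_n]) fixed_points (T i) !=set0) :
  (exists a : R, 0 < a < 1 /\
     quasi_firmly_nonexpansive r c a (operator_combination w T)) /\
  (exists a : R, 0 < a < 1 /\
     quasi_firmly_nonexpansive r c a (operator_composition T)).
Proof.
have r_gt0 : 0 < r by exact: lt_le_trans hr.
have c_gt0 : 0 < c by case: hX.
have [z z_fix] := hfix.
have Tz i : fixed_points (T i) z by exact: z_fix.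
pose k i := c / 2 * ((1 - alpha i) / alpha i).
have k_gt0 i : 0 < k i.
  have /andP[a_gt0 a_lt1] := halpha i.
  by rewrite mulr_gt0 ?divr_gt0 ?subr_gt0.
have T_firm i : has_firm_rate r (k i) (T i).
  exact: quasi_firmly_nonexpansive_rate (hT i).
have w_ge0 i : 0 <= w i by case/andP: (hw i).
split.
  have [m m_gt0 S_firm] :=
    has_firm_rate_combination hX w_ge0 hw1 k_gt0 T_firm Tz.
  apply: has_firm_rate_quasi c_gt0 m_gt0 _ S_firm.
  exists z; rewrite /fixed_points/= /operator_combination.
  under eq_bigr do rewrite Tz.
  by rewrite -scaler_suml hw1 scale1r.
have [Cz [m m_gt0 C_firm]] :=
  has_firm_rate_composition hX r_gt0 k_gt0 T_firm Tz.
by apply: has_firm_rate_quasi c_gt0 m_gt0 _ C_firm; exists z.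
Qed.
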